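(* If $f:\mathbb{R}^n\to\mathbb{R}$ is a weakly unimodal payoff function, then $f$ is reasonable.
   Context: A dart is a random vector $X$ taking values in $\mathbb{R}^n$. A payoff function is a measurable function $f:\mathbb{R}^n\to\mathbb{R}$ which is bounded from above (so expectations exist in $[-\infty,\infty)$). For $d>0$, $g_{X,f}(d):=\sup_{a\in\mathbb{R}^n}Ef(a+dX)$. The pair $(X,f)$ is reasonable if $g_{X,f}(d)$ is decreasing in $d\in(0,\infty)$. A payoff function $f$ is reasonable if $(X,f)$ is reasonable for all darts $X$ taking values in $\mathbb{R}^n$. A function $f:\mathbb{R}^n\to\mathbb{R}$ is weakly unimodal if for all $x\in\mathbb{R}^n$, $f(rx)$ is decreasing in $r$ on $[0,\infty)$. ''Decreasing'' means non-increasing. *)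

(* Defs.v *)
From HB Require Import structures.
From mathcomp Require Import all_boot all_order all_algebra.
From mathcomp Require Import all_classical all_reals all_analysis.

Set Implicit Arguments.
Unset Strict Implicit.
Unset Printing Implicit Defensive.

Import Order.TTheory GRing.Theory Num.Theory.
Import numFieldNormedType.Exports.

Local Open Scope classical_set_scope.
Local Open Scope ring_scope.

(* 'rV[R]_n with its Borel sigma-algebra, generated by the open sets of the
   usual (product) topology; convertible to 'rV[R]_n as a type. *)
Definition borel_rV (R : realType) (n : nat) :=
  g_sigma_algebraType (@open 'rV[R]_n).

Definition payoff (R : realType) (n : nat) (f : 'rV[R]_n -> R) : Prop :=
  measurable_fun [set: borel_rV R n] (f : borel_rV R n -> R) /\
  exists M : R, forall x : 'rV[R]_n, f x <= M.

Definition weakly_unimodal (R : realType) (n : nat) (f : 'rV[R]_n -> R)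
    : Prop :=
  forall (x : 'rV[R]_n) (r s : R),
    0 <= r -> r <= s -> f (s *: x) <= f (r *: x).

(* For a payoff function f the integrand is bounded from above, so that
   'E_P[_] is the expectation in the extended reals, with values < +oo. *)
Definition best_payoff (R : realType) (n : nat) (d : measure_display)
    (T : measurableType d) (P : probability T R)
    (X : {RV P >-> borel_rV R n}) (f : 'rV[R]_n -> R) (t : R) : \bar R :=
  ereal_sup [set 'E_P[fun w => f (a + t *: (X w : 'rV[R]_n))%R]
            | a in [set: 'rV[R]_n]]%E.

Definition reasonable_pair (R : realType) (n : nat) (d : measure_display)
    (T : measurableType d) (P : probability T R)
    (X : {RV P >-> borel_rV R n}) (f : 'rV[R]_n -> R) : Prop :=
  forall s t : R, 0 < s -> s <= t ->
    (best_payoff X f t <= best_payoff X f s)%E.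

Definition reasonable (R : realType) (n : nat) (f : 'rV[R]_n -> R) : Prop :=
  forall (d : measure_display) (T : measurableType d) (P : probability T R)
    (X : {RV P >-> borel_rV R n}), reasonable_pair X f.

(* Main.v *)
Require Import Defs.
From mathcomp Require Import all_boot all_order all_algebra.
From mathcomp Require Import all_classical all_reals all_analysis.

(** Weak unimodality says that shrinking a point towards the origin can only
    increase the payoff.  Given scales [0 < s <= t] and an aiming point [a] for
    scale [t], aim instead at [(s / t) a] with scale [s]: the dart then lands
    at [(s / t) a + s X = (s / t) (a + t X)], the point hit before shrunk by
    the factor [s / t <= 1].  So the payoff improves pointwise
    ([weakly_unimodal_shrink]), hence in expectation ([le_expectationT]), and
    every value competing in the supremum at [t] is dominated by one competing
    at [s].  The expectations may equal [-oo], which is why the comparison of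
    expectations cannot go through integrability. *)

Import Order.TTheory GRing.Theory Num.Theory.
Local Open Scope classical_set_scope.
Local Open Scope ring_scope.

(** The integral of a nonnegative function is the supremum of the integrals of
    the simple functions below it, and a larger function has more of them. *)
Lemma ge0_le_integralT {d : measure_display} {T : measurableType d}
    {R : realType} (mu : {measure set T -> \bar R}) (f g : T -> \bar R) :
  (forall x, 0 <= f x)%E -> (forall x, f x <= g x)%E ->
  (\int[mu]_x f x <= \int[mu]_x g x)%E.
Proof.
move=> f0 fg; have g0 x : (0 <= g x)%E by apply: le_trans (fg x).
rewrite !ge0_integralTE//; apply: ereal_sup_le => _ [h hf <-].
by exists h => // x; exact: le_trans (hf x) (fg x).
Qed.

(** Passing from [f] to a larger [g] raises the positive part and lowers the
    negative part; no cancellation problem arises because subtraction on the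
    extended reals is monotone even with the convention [+oo - +oo = -oo]. *)
Lemma le_expectationT {d : measure_display} {T : measurableType d}
    {R : realType} (P : probability T R) (f g : T -> R) :
  (forall x, f x <= g x) -> ('E_P[f] <= 'E_P[g])%E.
Proof.
move=> fg; rewrite !unlock integralE [leRHS]integralE.
have fgE : {in [set: T], forall x, ((EFin \o f) x <= (EFin \o g) x)%E}.
  by move=> x _; rewrite lee_fin.
apply: leeB; apply: ge0_le_integralT => // x.
- by apply: (funepos_le fgE); rewrite inE.
- by apply: (funeneg_le fgE); rewrite inE.
Qed.

Lemma weakly_unimodal_shrink {R : realType} {n : nat} (f : 'rV[R]_n -> R)
    (c : R) (x : 'rV[R]_n) :
  weakly_unimodal f -> 0 <= c <= 1 -> f x <= f (c *: x).
Proof.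
by move=> uf /andP[c0 c1]; have := uf x c 1 c0 c1; rewrite scale1r.
Qed.

Theorem proposition1p23 (R : realType) (n : nat) (f : 'rV[R]_n -> R) :
  payoff f -> weakly_unimodal f -> reasonable f.
Proof.
move=> _ uf d T P X s t s0 st; have t0 : 0 < t by exact: lt_le_trans st.
apply: ge_ereal_sup => _ [a _ <-].
(* Aiming at [(s / t) a] keeps the new landing point on the segment from the
   origin to the old one. *)
apply: (@le_trans _ _ ('E_P[fun w =>
    f (((s / t) *: a) + s *: (X w : 'rV[R]_n))%R])%E); last first.
  by apply: ereal_sup_ubound; exists ((s / t) *: a).
apply: le_expectationT => w.
have -> : (s / t) *: a + s *: (X w : 'rV[R]_n) =
          (s / t) *: (a + t *: (X w : 'rV[R]_n)).
  by rewrite scalerDr scalerA divfK// gt_eqF.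
apply: weakly_unimodal_shrink => //.
by apply/andP; split; [rewrite divr_ge0 ?ltW | rewrite ler_pdivrMr// mul1r].
Qed.
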